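(* Let $\alpha\ge \frac14(\sqrt{17}-1)$. Consider the following algorithm for the split scheduling problem with uniform setup times on $m$ machines: process the jobs in order of non-decreasing processing time; when job $j$ is considered, set $\ell_j:=\min\{\lceil \alpha p_j/s\rceil, m\}$ and schedule job $j$ (after everything already scheduled) on at most $\ell_j$ of the machines with minimum current load, splitting it (with one setup of length $s$ per machine used) so that it completes as early as possible subject to using at most $\ell_j$ machines. Then for every instance, the total completion time of the schedule produced is at most $(2+\alpha)$ times the minimum possible total completion time.
   Context: Split scheduling with uniform setup times: there are $m$ identical parallel machines and $n$ jobs; job $j$ has processing time $p_j\ge 0$, and there is a setup time $s>0$. Each job may be split into parts of arbitrary positive lengths summing to $p_j$, which may be processed on any machines, and parts of the same job may be processed simultaneously on different machines. Before processing a job part, the machine on which it is processed must perform a setup of length $s$; during a setup the machine cannot process or set up anything else, and each machine processes at most one thing at a time. The completion time $C_j$ of job $j$ is the time at which its last part finishes; the objective is to minimise $\sum_j C_j$. The load of a machine in a partial schedule is the time at which the last setup or job part assigned to it ends. *)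

(* Defs.v *)
From mathcomp Require Import all_boot all_order all_algebra.
From mathcomp Require Import reals.

Set Implicit Arguments.
Unset Strict Implicit.
Unset Printing Implicit Defensive.

Import Order.TTheory GRing.Theory Num.Theory.

Local Open Scope ring_scope.

Section SplitScheduling.
Variables (R : realType) (m n : nat).

(* The machine is idle, but stays set up, between the end of the setup and
   [proc_start]. *)
Record part := Part {
  machine : 'I_m;
  job : 'I_n;
  setup_start : R;
  proc_start : R;
  len : R
}.

Definition finish (a : part) : R := proc_start a + len a.

Definition schedule := seq part.

(* A job without parts, which in a feasible schedule is a job of processing
   time 0, completes at time 0. *)
Definition completion (S : schedule) (j : 'I_n) : R :=
  \big[Num.max/0]_(a <- S | job a == j) finish a.

Definition total_completion (S : schedule) : R := \sum_(j < n) completion S j.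

Definition load (S : schedule) (i : 'I_m) : R :=
  \big[Num.max/0]_(a <- S | machine a == i) finish a.

Definition valid_part (s : R) (a : part) : bool :=
  [&& 0 <= setup_start a, setup_start a + s <= proc_start a & 0 < len a].

(* A setup serves only the part that is processed next on its machine, so two
   parts on one machine cannot interleave their setups and processing. *)
Definition compatible (a b : part) : bool :=
  (machine a == machine b) ==>
  ((finish a <= setup_start b) || (finish b <= setup_start a)).

Definition feasible (p : 'I_n -> R) (s : R) (S : schedule) : Prop :=
  [/\ all (valid_part s) S,
      pairwise compatible S &
      forall j, \sum_(a <- S | job a == j) len a = p j].

Definition max_machines (p : 'I_n -> R) (s alpha : R) (j : 'I_n) : nat :=
  minn `|Num.ceil (alpha * p j / s)|%N m.

(* [q i] is the amount of job [j] processed on machine [i] of [M]. *)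
Definition append_job (s : R) (S : schedule) (j : 'I_n)
    (M : {set 'I_m}) (q : 'I_m -> R) : schedule :=
  S ++ [seq Part i j (load S i) (load S i + s) (q i) | i <- enum M].

Definition least_loaded (S : schedule) (M : {set 'I_m}) : Prop :=
  forall i k, i \in M -> k \notin M -> load S i <= load S k.

Definition admissible_split (p : 'I_n -> R) (l : nat) (S : schedule)
    (j : 'I_n) (M : {set 'I_m}) (q : 'I_m -> R) : Prop :=
  [/\ (#|M| <= l)%N,
      least_loaded S M,
      forall i, i \in M -> 0 < q i &
      \sum_(i in M) q i = p j].

Definition greedy_step (p : 'I_n -> R) (s alpha : R) (S : schedule)
    (j : 'I_n) (S' : schedule) : Prop :=
  exists (M : {set 'I_m}) (q : 'I_m -> R),
    let l := max_machines p s alpha j in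
    [/\ admissible_split p l S j M q,
        forall (M' : {set 'I_m}) (q' : 'I_m -> R),
          admissible_split p l S j M' q' ->
          completion (append_job s S j M q) j <=
          completion (append_job s S j M' q') j &
        S' = append_job s S j M q].

Inductive greedy_run (p : 'I_n -> R) (s alpha : R) :
    seq 'I_n -> schedule -> Prop :=
| greedy_nil : greedy_run p s alpha [::] [::]
| greedy_rcons (js : seq 'I_n) (j : 'I_n) (S S' : schedule) :
    greedy_run p s alpha js S -> greedy_step p s alpha S j S' ->
    greedy_run p s alpha (rcons js j) S'.

(* A relation, because ties between processing times and between machine
   loads may be broken arbitrarily. *)
Definition algorithm_output (p : 'I_n -> R) (s alpha : R)
    (S : schedule) : Prop :=
  exists js : seq 'I_n,
    [/\ perm_eq js (enum 'I_n),
        sorted (fun i j => p i <= p j) js &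
        greedy_run p s alpha js S].

End SplitScheduling.

(* Main.v *)
(* Only the jobs of positive length matter; number them p_1 <= ... <= p_N and
   let P_j be the j-th prefix sum. Before job j the algorithm has used at most
   (1 + alpha) P_(j-1) + s (j - 1) machine time, the l_j least loaded machines
   are at most as loaded as the average, and p_j / l_j is at most
   max (r_j, p_j / m) with r_j = min (p_j, s / alpha), so that
     m C_j <= (1 + alpha) P_j + s (j - 1) + s m + m r_j.
   In any schedule, by the j-th completion time C*_j at least j setups have
   been made, and each machine has either made one or been idle long enough to
   make one, so that m C*_j >= P_j + s max (j, m) after summation over j, the
   sum of the prefix sums being least in non-decreasing order. It remains to
   bound the sum of the m r_j by that of the P_j plus m (s / alpha) min (N, m),
   and then to use 1 / alpha <= alpha + 1 / 2. *)
Require Import Defs.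
From mathcomp Require Import all_boot all_order all_algebra.
From mathcomp Require Import reals.
From mathcomp Require Import ring lra zify.

Set Implicit Arguments.
Unset Strict Implicit.
Unset Printing Implicit Defensive.

Import Order.TTheory GRing.Theory Num.Theory.

Local Open Scope ring_scope.

(** * Iterated maxima and packings of intervals *)

Lemma bigmax_seq_leE (R : realDomainType) (A : Type) (l : seq A) (P : pred A)
    (F : A -> R) (x0 x : R) :
  (\big[Num.max/x0]_(a <- l | P a) F a <= x) =
  (x0 <= x) && all (fun a => P a ==> (F a <= x)) l.
Proof.
elim: l => [|a l IH]; first by rewrite big_nil andbT.
rewrite big_cons /=; case: (P a) => //=.
by rewrite ge_max IH andbCA.
Qed.

(** The head interval divides the others into those that end before it starts and those that start
    after it ends, and its two ends cut the window accordingly. Neither group is the tail itself,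
    hence the induction on a bound for the size. *)
Lemma sum_disjoint_intervals (R : realDomainType) (A : Type) (b e : A -> R)
    (l : seq A) (u v : R) :
  u <= v ->
  all (fun a => [&& u <= b a, b a <= e a & e a <= v]) l ->
  pairwise (fun a c => (e a <= b c) || (e c <= b a)) l ->
  \sum_(a <- l) (e a - b a) <= v - u.
Proof.
elim: {l}_.+1 {-2}l (ltnSn (size l)) u v => // k IH [|a l] /= szl u v uv.
  by move=> _ _; rewrite big_nil subr_ge0.
move=> /andP[/and3P[ua aa av] lin] /andP[disj pw].
rewrite big_cons (bigID (fun c => e c <= b a)) /=.
have sz1 (P : pred A) : (size [seq c <- l | P c] < k)%N.
  by rewrite size_filter; apply: leq_ltn_trans (count_size _ _) _.
have before : \sum_(c <- l | e c <= b a) (e c - b c) <= b a - u.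
  rewrite -big_filter; apply: IH => //; last exact: pairwise_filter.
  rewrite all_filter; apply: sub_all lin => c /and3P[uc cc _].
  by apply/implyP => ->; rewrite uc cc.
have after : \sum_(c <- l | ~~ (e c <= b a)) (e c - b c) <= v - e a.
  rewrite -big_filter; apply: IH => //; last exact: pairwise_filter.
  rewrite all_filter; have := disj; have := lin; elim: (l) => //= c r IHr.
  move=> /andP[/and3P[_ cc cv] linr] /andP[ac disjr].
  rewrite IHr // andbT; apply/implyP => ncba.
  by move: ac; rewrite (negPf ncba) orbF cc cv => ->.
by move: before after; lra.
Qed.

(** * Sums of prefix sums *)

(** An entry is counted once for each prefix that contains it, so the head has weight [size xs]. *)
Fixpoint prefix_sums (R : pzSemiRingType) (xs : seq R) : R :=
  if xs is x :: xs' then x *+ size xs + prefix_sums xs' else 0.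

Lemma prefix_sums_rcons (R : pzSemiRingType) (xs : seq R) (x : R) :
  prefix_sums (rcons xs x) = prefix_sums xs + (\sum_(y <- xs) y + x).
Proof.
elim: xs => [|y xs IH] /=; first by rewrite big_nil addr0 !add0r.
rewrite IH big_cons size_rcons [y *+ (size xs).+2]mulrSr -!addrA.
by congr (_ + _); rewrite addrCA.
Qed.

Lemma ler_prefix_sums_map (R : numDomainType) (A : Type) (f g : A -> R)
    (l : seq A) :
  (forall a, f a <= g a) -> prefix_sums (map f l) <= prefix_sums (map g l).
Proof.
by move=> fg; elim: l => //= a l IH; rewrite !size_map lerD // lerMn2r fg orbT.
Qed.

(* Each unordered pair of positions contributes its first entry to the sum of
   the prefix sums, and the first entry is the minimum of the pair precisely
   when the order is non-decreasing. *)
Lemma prefix_sums_pairs (R : realDomainType) (xs : seq R) :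
  \sum_(x <- xs) \sum_(y <- xs) Num.min x y + \sum_(x <- xs) x
    <= prefix_sums xs *+ 2 ?= iff pairwise <=%R xs.
Proof.
elim: xs => [|x xs IH] /=.
  by rewrite !big_nil addr0 mul0rn; split; rewrite ?lexx ?eqxx.
have le_row : \sum_(y <- xs) Num.min x y <= x *+ size xs ?= iff all (>= x) xs.
  elim: xs {IH} => [|y xs IHxs] /=.
    by rewrite big_nil; split; rewrite ?lexx ?eqxx.
  rewrite big_cons mulrS; apply: leifD IHxs.
  by split; rewrite ?eq_le ge_min lexx // le_min lexx.
have ->: \sum_(a <- x :: xs) \sum_(b <- x :: xs) Num.min a b
    + \sum_(a <- x :: xs) a = x *+ 2 + \sum_(y <- xs) Num.min x y
      + \sum_(y <- xs) Num.min x y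
      + (\sum_(a <- xs) \sum_(b <- xs) Num.min a b + \sum_(a <- xs) a).
  have -> : \sum_(a <- x :: xs) \sum_(b <- x :: xs) Num.min a b =
      \sum_(a <- x :: xs) (Num.min x a + \sum_(b <- xs) Num.min a b).
    by apply: eq_bigr => a _; rewrite big_cons minC.
  by rewrite !big_cons minxx big_split /=; ring.
have ->: (x *+ (size xs).+1 + prefix_sums xs) *+ 2
    = x *+ 2 + x *+ size xs + x *+ size xs + prefix_sums xs *+ 2.
  by rewrite mulrS; ring.
rewrite -[all _ _]andbb -[X in X && _ && _]andTb.
apply: leifD (leifD (leifD _ le_row) le_row) IH.
by split; rewrite ?lexx ?eqxx.
Qed.

(** The left-hand side of [prefix_sums_pairs] is invariant under permutation; the sorted sequence
    attains it, any other order is bounded below by it. *)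
Lemma le_prefix_sums_sorted (R : realDomainType) (xs ys : seq R) :
  perm_eq xs ys -> sorted <=%R xs -> prefix_sums xs <= prefix_sums ys.
Proof.
move=> xsys; rewrite le_sorted_pairwise => xs_sorted.
have -> : prefix_sums xs <= prefix_sums ys
    = (prefix_sums xs *+ 2 <= prefix_sums ys *+ 2) by rewrite lerMn2r.
have [_] := prefix_sums_pairs xs; rewrite xs_sorted => /eqP <-.
have [+ _] := prefix_sums_pairs ys; apply: le_trans.
rewrite le_eqVlt (perm_big _ xsys) [X in _ + X](perm_big _ xsys) /=.
apply/orP; left; apply/eqP; congr (_ + _).
by apply: eq_bigr => x _; rewrite (perm_big _ xsys).
Qed.

Lemma prefix_sums_ge0 (R : numDomainType) (xs : seq R) :
  all (>= 0) xs -> 0 <= prefix_sums xs.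
Proof.
elim: xs => //= x xs IH /andP[x0 /IH xs0].
by rewrite addr_ge0 // mulrn_wge0.
Qed.

Lemma sum_le_prefix_sums (R : realDomainType) (m : nat) (c : R) (xs : seq R) :
  0 <= c -> all (fun x => 0 <= x <= c) xs ->
  m%:R * \sum_(x <- xs) x <= prefix_sums xs + m%:R * c * (minn (size xs) m)%:R.
Proof.
move=> c0; elim/last_ind: xs => [|xs x IH].
  by rewrite big_nil !mulr0 min0n mulr0 addr0.
rewrite all_rcons => /andP[/andP[x0 xc] xsP].
(* Once the running sum exceeds [m * c], the prefix sums pay for new terms. *)
have [big | small] := lerP (m%:R * c) (\sum_(y <- xs) y + x).
  have mono : m%:R * c * (minn (size xs) m)%:R
      <= m%:R * c * (minn (size xs).+1 m)%:R.
    by rewrite ler_wpM2l ?mulr_ge0 // ler_nat; lia.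
  have mx : m%:R * x <= m%:R * c by rewrite ler_wpM2l.
  rewrite prefix_sums_rcons size_rcons big_rcons /= mulrDr.
  by have := IH xsP; lra.
have ps0 : 0 <= prefix_sums (rcons xs x).
  apply: prefix_sums_ge0; rewrite all_rcons /= x0.
  by apply: sub_all xsP => y /andP[].
suff : \sum_(y <- rcons xs x) y <= c * (minn (size (rcons xs x)) m)%:R.
  by move=> /(ler_wpM2l (ler0n R m)); rewrite mulrA; lra.
have [szm|szm] := leqP (size (rcons xs x)) m.
  rewrite mulr_natr.
  have : all (fun x => x <= c) (rcons xs x).
    by rewrite all_rcons xc; apply: sub_all xsP => y /andP[].
  elim: (rcons _ _) => [|y ys IHy] /=; first by rewrite big_nil.
  by move=> /andP[yc /IHy ysc]; rewrite big_cons mulrS lerD.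
by rewrite big_rcons /= mulrC ltW.
Qed.

(** * Numerical inequalities in [alpha] *)

(** For [N <= m] every maximum is [m], and the sum of the [k] is at most [N * m / 2], which turns
    [alpha + 1 / 2] into [alpha + 1]. Beyond [m] the first term is frozen, and a new term [N + m] is
    at most twice the new maximum [N.+1]. *)
Lemma sum_max_count (R : realFieldType) (alpha c : R) (m N : nat) :
  0 <= alpha -> c <= alpha + 1 / 2 ->
  m%:R * c * (minn N m)%:R + \sum_(k < N) (k + m)%:R
    <= (2 + alpha) * \sum_(k < N) (maxn k.+1 m)%:R.
Proof.
move=> a0 ca.
have small n : (n <= m)%N -> m%:R * c * n%:R + \sum_(k < n) (k + m)%:R
    <= (2 + alpha) * \sum_(k < n) (maxn k.+1 m)%:R.
  move=> nm.
  have -> : \sum_(k < n) (maxn k.+1 m)%:R = n%:R * m%:R :> R.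
    rewrite (eq_bigr (fun=> m%:R)) ?sumr_const ?card_ord ?mulr_natl // => k _.
    by rewrite (maxn_idPr _) // (leq_trans _ nm).
  have gauss : (\sum_(k < n) (k + m)%:R) *+ 2 + n%:R
      = n%:R * n%:R + n%:R * m%:R *+ 2 :> R.
    elim: (n) => [|n' IHn]; first by rewrite big_ord0; ring.
    move: IHn; rewrite big_ord_recr /= -natr1 natrD; lra.
  have nnm : n%:R * n%:R <= n%:R * m%:R :> R by rewrite ler_wpM2l ?ler_nat.
  have := ler_wpM2l (mulr_ge0 (ler0n R m) (ler0n R n)) ca.
  by have := ler0n R n; lra.
have [|/ltnW] := leqP N m; first exact: small.
elim: N => [|N IHN].
  by rewrite leqn0 => /eqP m0; rewrite m0 in small *; apply: (small 0%N).
rewrite leq_eqVlt => /predU1P[<-|]; first exact: small.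
rewrite ltnS => mN; have := IHN mN.
rewrite !big_ord_recr /=.
rewrite (maxn_idPl (leqW mN)).
have : (N + m)%:R <= 2 * N.+1%:R :> R by rewrite -natrM ler_nat; lia.
have : 0 <= alpha * N.+1%:R by rewrite mulr_ge0.
by lra.
Qed.

(** The threshold is the positive root of [x ^+ 2 + x / 2 = 1]. *)
Lemma inv_le_add_half (R : rcfType) (alpha : R) :
  (Num.sqrt 17 - 1) / 4 <= alpha -> 0 < alpha /\ alpha^-1 <= alpha + 1 / 2.
Proof.
move=> halpha.
have sq : Num.sqrt 17 ^+ 2 = 17 :> R by rewrite sqr_sqrtr.
have r0 : 0 <= Num.sqrt 17 :> R := sqrtr_ge0 17.
have a0 : 0 < alpha by nra.
split=> //; rewrite -[alpha^-1]mul1r ler_pdivrMr //.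
by nra.
Qed.

(** Truncation at [s / alpha] makes [sum_le_prefix_sums] applicable and can only lower the prefix
    sums; [sum_max_count] with [c = alpha^-1], scaled by [s], absorbs the remainder. *)
Lemma potential_bound (R : rcfType) (alpha s : R) (m : nat) (xs : seq R) :
  (Num.sqrt 17 - 1) / 4 <= alpha -> 0 < s -> all (>= 0) xs ->
  m%:R * \sum_(x <- xs) Num.min x (s / alpha)
    + s * \sum_(k < size xs) (k + m)%:R
  <= prefix_sums xs + (2 + alpha) * (s * \sum_(k < size xs) (maxn k.+1 m)%:R).
Proof.
move=> /inv_le_add_half[a0 ainv] s0 xs0.
have c0 : 0 <= s / alpha by rewrite divr_ge0 ?ltW.
pose ys := [seq Num.min x (s / alpha) | x <- xs].
have ysP : all (fun y => 0 <= y <= s / alpha) ys.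
  rewrite all_map; apply: sub_all xs0 => x x0 /=.
  by rewrite le_min x0 c0 ge_min lexx orbT.
have := sum_le_prefix_sums m c0 ysP; rewrite big_map size_map.
have : prefix_sums ys <= prefix_sums xs.
  rewrite -[leRHS](congr1 _ (map_id xs)).
  by apply: (@ler_prefix_sums_map _ _ _ id) => x; rewrite ge_min lexx.
have := ler_wpM2l (ltW s0) (sum_max_count m (size xs) (ltW a0) ainv).
by lra.
Qed.

(** * Lower bound for feasible schedules *)

Section Feasible.
Variables (R : realType) (m n : nat) (p : 'I_n -> R) (s : R).
Hypothesis s_gt0 : 0 < s.
Variable T : schedule R m n.
Hypothesis T_feasible : feasible p s T.

Lemma completion_ge0 (S : schedule R m n) j : 0 <= completion S j.
Proof.
have := lexx (completion S j).
by rewrite {1}/completion bigmax_seq_leE => /andP[].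
Qed.

Lemma feasible_work_le (J : seq 'I_n) (t : R) :
  uniq J -> (0 < size J)%N -> {in J, forall j, 0 < p j} ->
  {in J, forall j, completion T j <= t} ->
  \sum_(j <- J) p j + s * (maxn (size J) m)%:R <= m%:R * t.
Proof.
case: T_feasible => valid compat sum_len uniqJ J_gt0 pJ CJ.
pose TJ := [seq a <- T | job a \in J].
have TJP : all (fun a => valid_part s a && (finish a <= t)) TJ.
  rewrite all_filter; have {CJ} : forall j, j \in J ->
      all (fun a => (job a == j) ==> (finish a <= t)) T.
    by move=> j /CJ; rewrite /completion bigmax_seq_leE => /andP[].
  elim: (T) valid => //= a l IH /andP[va vl] CJ; rewrite IH // ?andbT.
    by apply/implyP => aJ; rewrite va; have /andP[] := CJ _ aJ; rewrite eqxx.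
  by move=> j /CJ /andP[].
have t_ge0 : 0 <= t.
  case: (J) J_gt0 CJ => // j l _ /(_ j (mem_head _ _)).
  exact: le_trans (completion_ge0 _ _).
have machine_work i :
    \sum_(a <- TJ | machine a == i) (len a + s) <= t.
  pose l := [seq a <- TJ | machine a == i].
  rewrite -big_filter -/l -[leRHS]subr0.
  (* A part occupies its machine from the start of its setup to its finish, including any wait in
     between; these intervals are disjoint. *)
  apply: le_trans (_ : \sum_(a <- l) (finish a - setup_start a) <= _).
    rewrite /l /TJ !big_filter !big_filter_cond; elim: (T) valid => [|a r IH] /=.
      by rewrite !big_nil.
    move=> /andP[/and3P[_ le_start _] /IH le_r]; rewrite !big_cons.
    by do !case: ifP => // _; rewrite lerD // /finish; lra.
  apply: sum_disjoint_intervals => //.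
    rewrite all_filter; apply: sub_all TJP => a /andP[/and3P[b0 bs l0] at_].
    apply/implyP => _; rewrite b0 at_ /= andbT /finish.
    by move: (ltW s_gt0); lra.
  have : pairwise (@compatible R m n) l by rewrite !pairwise_filter.
  have : all (fun a => machine a == i) l by apply: filter_all.
  elim: l => //= a l IH /andP[/eqP ai li] /andP[al ll]; rewrite IH // andbT.
  elim: l li al {IH ll} => //= c l IH /andP[/eqP ci li] /andP[ac al].
  by rewrite IH // andbT; move: ac; rewrite /compatible ai ci eqxx.
have sum_machines (F : part R m n -> R) :
    \sum_(a <- TJ) F a = \sum_(i < m) \sum_(a <- TJ | machine a == i) F a.
  exact: (partition_big (fun a => machine a) predT).
have sum_jobs (F : part R m n -> R) :
    \sum_(a <- TJ) F a = \sum_(j <- J) \sum_(a <- T | job a == j) F a.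
  rewrite big_filter [RHS]big_uniq //=.
  rewrite (partition_big (fun a => job a) (mem J)) //=.
  apply: eq_bigr => j jJ; apply: eq_bigl => a.
  by case: eqP => [->|]; rewrite ?jJ ?andbF.
have len_TJ : \sum_(a <- TJ) len a = \sum_(j <- J) p j.
  by rewrite sum_jobs; apply: eq_bigr => j _.
(* A job of positive length has at least one part. *)
have size_TJ : (size J)%:R <= (size TJ)%:R :> R.
  have -> : (size TJ)%:R = \sum_(a <- TJ) 1 :> R.
    by rewrite big_const_seq count_predT iter_addr_0.
  have -> : (size J)%:R = \sum_(j <- J) 1 :> R.
    by rewrite big_const_seq count_predT iter_addr_0.
  rewrite sum_jobs [leLHS]big_seq [leRHS]big_seq; apply: ler_sum => j /pJ.
  rewrite -sum_len; elim: (T) => [|a l IH]; first by rewrite big_nil ltxx.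
  rewrite !big_cons; case: ifP => // _ _.
  by rewrite lerDl sumr_ge0.
have sum_t : \sum_(i < m) t = m%:R * t.
  by rewrite sumr_const card_ord mulr_natl.
have [_|_] := leqP m (size J).
  rewrite -len_TJ; apply: le_trans (_ : \sum_(a <- TJ) (len a + s) <= _).
    rewrite big_split /= lerD2l big_const_seq count_predT iter_addr_0.
    by rewrite -[leRHS]mulr_natr ler_wpM2l // ltW.
  by rewrite sum_machines -sum_t; apply: ler_sum.
(* Since [J] is nonempty, some part, and so some complete setup, lies before [t]. *)
have s_le_t : s <= t.
  move: TJP size_TJ; case: (TJ) => [|a l] /=.
    by rewrite ler_nat leqNgt J_gt0.
  move=> /andP[/andP[/and3P[b0 bs l0] at_] _] _.
  by move: at_; rewrite /finish; lra.
rewrite -len_TJ sum_machines -sum_t mulr_natr.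
rewrite -[X in _ *+ X]card_ord -sumr_const.
rewrite -big_split; apply: ler_sum => i _ /=.
have := machine_work i.
(* A machine without parts is covered by [s <= t]; on any other, only the setup of the first listed
   part is kept. *)
elim: (TJ) => [|a l IH]; first by rewrite !big_nil add0r.
rewrite !big_cons; case: ifP => // _.
apply: le_trans; rewrite addrAC lerD2l; apply: ler_sum => c _.
by rewrite lerDl ltW.
Qed.

(** When a job of [J] completes, so have all those before it in [J]; [feasible_work_le] is applied
    to each nonempty prefix and the results are added. *)
Lemma feasible_total_ge (J : seq 'I_n) :
  uniq J -> {in J, forall j, 0 < p j} ->
  sorted (fun i j => completion T i <= completion T j) J ->
  prefix_sums (map p J) + s * \sum_(k < size J) (maxn k.+1 m)%:R
    <= m%:R * \sum_(j <- J) completion T j.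
Proof.
rewrite sorted_pairwise; last by move=> i j k; apply: le_trans.
elim/last_ind: J => [|J j IH]; first by rewrite big_nil big_ord0 !mulr0 addr0.
move=> uniqJ pJ; rewrite pairwise_rcons => /andP[/allP CJ sortedJ].
have work : \sum_(i <- rcons J j) p i + s * (maxn (size J).+1 m)%:R
    <= m%:R * completion T j.
  rewrite -(size_rcons J j); apply: feasible_work_le; rewrite ?size_rcons //.
  by move=> i; rewrite mem_rcons inE => /predU1P[->//|/CJ].
move: uniqJ; rewrite rcons_uniq => /andP[_ uniqJ].
have pJ' : {in J, forall i, 0 < p i}.
  by move=> i iJ; apply: pJ; rewrite mem_rcons inE iJ orbT.
have {}IH := IH uniqJ pJ' sortedJ.
rewrite map_rcons prefix_sums_rcons size_rcons big_ord_recr big_rcons /=.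
rewrite !mulrDr big_map; move: work IH; rewrite big_rcons /=; lra.
Qed.
End Feasible.

(** * Upper bound for the greedy schedule *)

Section Greedy.
Variables (R : realType) (m n : nat) (p : 'I_n -> R) (s alpha : R).
Hypothesis p_ge0 : forall j, 0 <= p j.
Hypothesis s_gt0 : 0 < s.
Hypothesis alpha_gt0 : 0 < alpha.
Implicit Types (S : schedule R m n) (M : {set 'I_m}).

Lemma load_ge0 S i : 0 <= load S i.
Proof.
by have := lexx (load S i); rewrite {1}/load bigmax_seq_leE => /andP[].
Qed.

Lemma least_loadedD1 S M (i0 : 'I_m) :
  least_loaded S M -> (forall i, i \in M -> load S i <= load S i0) ->
  least_loaded S (M :\ i0).
Proof.
move=> leastM i0max i k; rewrite !inE negb_and negbK => /andP[_ iM].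
by case/orP => [/eqP-> | kM]; [apply: i0max | apply: leastM].
Qed.

Lemma exists_max_load S M :
  (0 < #|M|)%N ->
  exists2 i0, i0 \in M & forall i, i \in M -> load S i <= load S i0.
Proof.
case/card_gt0P => i1 i1M.
by case: (arg_maxP (load S) i1M) => i0 i0M i0max; exists i0.
Qed.

(** Starting from all machines, a most loaded one is removed at a time, which never raises the
    average load; the averages are compared by cross-multiplication. *)
Lemma exists_least_loaded S k :
  (k <= m)%N -> exists M, [/\ #|M| = k, least_loaded S M &
    m%:R * \sum_(i in M) load S i <= k%:R * \sum_(i < m) load S i].
Proof.
move=> km; move def_d: (m - k)%N => d.
elim: d => [|d IH] in k km def_d *.
  have -> : k = m by lia.
  exists setT; split; first by rewrite cardsT card_ord.
    by move=> i k' _; rewrite inE.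
  by rewrite (eq_bigl xpredT) // => i; rewrite inE.
have [||M [cardM leastM avgM]] := IH k.+1; try by lia.
have [|i0 i0M i0max] := @exists_max_load S M; first by rewrite cardM.
exists (M :\ i0); split; last 1 first.
- have le_max : \sum_(i in M) load S i <= k.+1%:R * load S i0.
    by rewrite -cardM mulr_natl -sumr_const; apply: ler_sum.
  have split_sum : \sum_(i in M) load S i
      = load S i0 + \sum_(i in M :\ i0) load S i by apply: big_setD1.
  have k1 : 0 < k.+1%:R :> R by rewrite ltr0n.
  rewrite -(ler_pM2l k1).
  have := ler_wpM2l (ler0n R m) le_max.
  have := ler_wpM2l (ler0n R k) avgM.
  by rewrite split_sum -natr1; lra.
- by have := cardsD1 i0 M; rewrite cardM i0M; lia.
- exact: least_loadedD1.
Qed.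

(* Filling [M] up to a common level may call for a negative amount on the
   highest machine; leaving that machine out then lowers the level. *)
Lemma exists_balanced_split S M (P : R) :
  0 < P -> (0 < #|M|)%N -> least_loaded S M ->
  exists (M' : {set 'I_m}) (q : 'I_m -> R) (t : R),
    [/\ (#|M'| <= #|M|)%N /\ least_loaded S M',
        forall i, i \in M' -> 0 < q i,
        \sum_(i in M') q i = P,
        0 <= t /\ (forall i, i \in M' -> load S i + s + q i <= t) &
        #|M|%:R * t <= \sum_(i in M) (load S i + s) + P].
Proof.
move=> P0; move def_k: #|M| => k.
elim: k => [|k IH] in M def_k * => // _ leastM.
have k1 : 0 < k.+1%:R :> R by rewrite ltr0n.
(* The common finishing level when all of [M] is set up and filled with [P]. *)
pose t := (\sum_(i in M) (load S i + s) + P) / k.+1%:R.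
have tE : k.+1%:R * t = \sum_(i in M) (load S i + s) + P.
  by rewrite mulrC divfK // gt_eqF.
have t_ge0 : 0 <= t.
  apply: divr_ge0 (ltW k1); apply: addr_ge0 (ltW P0).
  by apply: sumr_ge0 => i _; apply: addr_ge0 (load_ge0 S i) (ltW s_gt0).
have [|i0 i0M i0max] := @exists_max_load S M; first by rewrite def_k.
have [low|high] := ltrP (load S i0 + s) t.
  exists M, (fun i => t - (load S i + s)), t; split; rewrite ?def_k ?tE //.
  - by move=> i /i0max; lra.
  - by rewrite sumrB sumr_const def_k -mulr_natl tE; lra.
  - by split=> // i _; lra.
have cardD : #|M :\ i0| = k by have := cardsD1 i0 M; rewrite def_k i0M; lia.
have split_sum : \sum_(i in M) (load S i + s)
    = load S i0 + s + \sum_(i in M :\ i0) (load S i + s) by apply: big_setD1.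
(* With a single machine, [t] would exceed [load S i0 + s] by [P], against [high]. *)
have k0 : (0 < k)%N.
  rewrite lt0n; apply/eqP => k0; move: tE; rewrite split_sum big1; last first.
    by move=> i; rewrite (cards0_eq (etrans cardD k0)) inE.
  by rewrite k0; lra.
have [M' [q [t' [[cM' lM'] q0 qP t'P ct']]]] :=
  IH _ cardD k0 (least_loadedD1 leastM i0max).
exists M', q, t'; split=> //; first by split=> //; apply: leqW.
have kp : 0 < k%:R :> R by rewrite ltr0n.
(* Dropping [i0] removes a term at least [t] from a total of [k.+1%:R * t]. *)
have le_t : t' <= t.
  by rewrite -(ler_pM2l kp); move: tE; rewrite split_sum -natr1; lra.
by rewrite -tE ler_wpM2l.
Qed.

(** The ceiling exceeds [alpha * p j / s] by less than one, which costs at most one more setup; and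
    unless the cap [m] takes effect, it leaves at most [s / alpha] of the job per machine. *)
Lemma max_machinesP j :
  let l := max_machines m p s alpha j in
  [/\ s * l%:R <= alpha * p j + s, (0 < m)%N -> 0 < p j -> (0 < l)%N &
      l = m \/ p j <= l%:R * (s / alpha)].
Proof.
rewrite /max_machines /=; set x := alpha * p j / s.
have x0 : 0 <= x by rewrite divr_ge0 ?mulr_ge0 // ltW.
have c0 : 0 <= Num.ceil x by rewrite ceil_ge0 (lt_le_trans _ x0) // ltrN10.
have cE : (`|Num.ceil x|%N)%:R = (Num.ceil x)%:~R :> R.
  by rewrite natr_absz ger0_norm.
have /andP[] := ceil_itv x; rewrite -cE rmorphB /= -cE => cx xc.
have sx : s * x = alpha * p j by rewrite mulrC divfK // gt_eqF.
split.
- have le_c : (minn `|Num.ceil x| m)%:R <= x + 1.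
    apply: le_trans (_ : (`|Num.ceil x|%N)%:R <= _).
      by rewrite ler_nat geq_minl.
    by move: cx; lra.
  by have := ler_wpM2l (ltW s_gt0) le_c; rewrite mulrDr sx mulr1.
- move=> m0 pj0; rewrite leq_min m0 andbT -(ltr0n R).
  by apply: lt_le_trans xc; rewrite divr_gt0 ?mulr_gt0.
- have [le_m|lt_m] := leqP `|Num.ceil x|%N m; last by left.
  right; rewrite mulrA ler_pdivlMr // mulrC -sx mulrC.
  by rewrite ler_wpM2r // ltW.
Qed.

Lemma load_append S j M q i : (forall i, i \in M -> 0 < q i) ->
  load (append_job s S j M q) i <= load S i + (if i \in M then s + q i else 0).
Proof.
move=> q0; have if0 : 0 <= if i \in M then s + q i else 0.
  by case: ifP => // /q0 qi; rewrite addr_ge0 // ltW.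
rewrite {1}/load bigmax_seq_leE addr_ge0 ?load_ge0 //= all_cat.
apply/andP; split.
  have : load S i <= load S i by [].
  rewrite {1}/load bigmax_seq_leE => /andP[_]; apply: sub_all => a.
  by case: (machine a == i) => //= h; apply: le_trans h _; rewrite lerDl.
rewrite all_map; apply/allP => k; rewrite mem_enum => kM /=.
by apply/implyP => /eqP <-; rewrite kM /finish /= addrA.
Qed.

Lemma completion_append_neq S j M q k : k != j ->
  completion (append_job s S j M q) k = completion S k.
Proof.
move=> kj; rewrite /completion -big_filter filter_cat.
rewrite (_ : [seq a <- map _ _ | _] = [::]) ?cats0 ?big_filter //.
by rewrite filter_map; elim: (enum M) => //= i l IH; rewrite eq_sym (negPf kj).
Qed.

Lemma completion_append_le S j M q t :
  all (fun a => job a != j) S -> 0 <= t ->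
  (forall i, i \in M -> load S i + s + q i <= t) ->
  completion (append_job s S j M q) j <= t.
Proof.
move=> Sj t0 Mt; rewrite /completion bigmax_seq_leE t0 all_cat /=.
apply/andP; split; first by apply: sub_all Sj => a /negPf ->.
by rewrite all_map; apply/allP => i; rewrite mem_enum => /Mt; rewrite /= eqxx.
Qed.

(** The greedy choice is no worse than a balanced split on [l] least loaded machines, which ends by
    their average load plus [s + p j / l]. *)
Lemma greedy_step_bound S j S' :
  greedy_step p s alpha S j S' -> 0 < p j -> all (fun a => job a != j) S ->
  m%:R * completion S' j <= \sum_(i < m) load S i + s * m%:R
    + m%:R * Num.min (p j) (s / alpha) + p j.
Proof.
case=> M [q [[cardM leastM q0 qP] opt ->]] pj0 Sj.
have m0 : (0 < m)%N.
  have [/card_gt0P[i _]|] := ltnP 0 #|M|.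
    exact: leq_ltn_trans (ltn_ord i).
  rewrite leqn0 cards_eq0 => /eqP M0.
  by move: pj0; rewrite -qP M0 big_set0 ltxx.
have [sl /(_ m0 pj0) l0 lP] := max_machinesP j.
set l := max_machines _ _ _ _ _ in cardM opt sl l0 lP.
have lm : (l <= m)%N by apply: geq_minr.
have [M1 [cardM1 leastM1 avgM1]] := exists_least_loaded S lm.
have [|M2 [q2 [t [[cM2 leastM2] q20 q2P [t0 Mt] tP]]]] :=
  exists_balanced_split pj0 _ leastM1; first by rewrite cardM1.
have : completion (append_job s S j M q) j <= t.
  apply: le_trans (opt M2 q2 _) _; first by split; rewrite // -cardM1.
  exact: completion_append_le.
have lp : 0 < l%:R :> R by rewrite ltr0n.
move=> /(ler_wpM2l (ler0n R m)) /le_trans; apply.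
rewrite -(ler_pM2l lp).
(* This is [p j / l <= Num.min (p j) (s / alpha) + p j / m] without denominators: the last term
   suffices when [l = m], the minimum otherwise. *)
have : m%:R * p j <= l%:R * (m%:R * Num.min (p j) (s / alpha) + p j).
  have r0 : 0 <= Num.min (p j) (s / alpha) by rewrite le_min !ltW ?divr_gt0.
  case: lP => [->|pl].
    by rewrite mulrDr lerDr !mulr_ge0.
  suff le_min : p j <= l%:R * Num.min (p j) (s / alpha).
    have := ler_wpM2l (ler0n R m) le_min.
    by have := mulr_ge0 (ltW lp) (ltW pj0); lra.
  rewrite minr_pMr ?(ltW lp) // le_min pl andbT.
  by rewrite -[leLHS]mul1r ler_wpM2r ?(ltW pj0) ?ler1n.
have := ler_wpM2l (ler0n R m) tP.
rewrite cardM1 big_split sumr_const cardM1 -[s *+ l]mulr_natl /=.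
by move: avgM1; lra.
Qed.

Lemma greedy_step_load S j S' :
  greedy_step p s alpha S j S' ->
  \sum_(i < m) load S' i
    <= \sum_(i < m) load S i + ((1 + alpha) * p j + s).
Proof.
case=> M [q [[cardM _ q0 qP] _ ->]].
apply: le_trans (ler_sum _ (fun i _ => load_append S j i q0)) _.
rewrite big_split lerD2l -big_mkcond big_split sumr_const qP /=.
have [sl _ _] := max_machinesP j.
have : s * #|M|%:R <= s * (max_machines m p s alpha j)%:R.
  by rewrite ler_wpM2l ?(ltW s_gt0) ?ler_nat.
by rewrite -mulr_natr; lra.
Qed.

Lemma greedy_step0 S j S' : greedy_step p s alpha S j S' -> p j = 0 -> S' = S.
Proof.
case=> M [q [[_ _ q0 qP] _ ->]] pj0.
suff -> : M = set0 by rewrite /append_job enum_set0 cats0.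
apply/eqP; rewrite -cards_eq0 -leqn0 leqNgt; apply/negP => /card_gt0P[i iM].
have : 0 < \sum_(i in M) q i.
  rewrite (bigD1 i) //= ltr_pwDl ?q0 //; apply: sumr_ge0 => k /andP[/q0 qk _].
  exact: ltW.
by rewrite qP pj0 ltxx.
Qed.

(** The three invariants go together: the first makes the next job new to [S], and the load bound
    feeds the completion bound. *)
Lemma greedy_run_bound js S :
  greedy_run p s alpha js S -> uniq js ->
  let xs := [seq p j | j <- js & 0 < p j] in
  [/\ all (fun a => job a \in js) S,
      \sum_(i < m) load S i
        <= (1 + alpha) * \sum_(x <- xs) x + s * (size xs)%:R &
      m%:R * \sum_(j <- js) completion S j
        <= (1 + alpha) * prefix_sums xs + s * \sum_(k < size xs) (k + m)%:R
           + m%:R * \sum_(x <- xs) Num.min x (s / alpha)].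
Proof.
elim=> {js S} [_|js j S S' _ IH step] /=.
  rewrite !big_nil big_ord0 !mulr0 !addr0; split=> //.
  by rewrite big1 // => i _; rewrite /load big_nil.
rewrite rcons_uniq => /andP[jjs /IH {IH} /= [jobsS loadS totalS]].
have Sj : all (fun a => job a != j) S.
  by apply: sub_all jobsS => a; apply: contraTneq => ->.
have jobsS' : all (fun a => job a \in rcons js j) S'.
  case: step => M [q [_ _ ->]]; rewrite all_cat all_map.
  apply/andP; split; last by apply/allP => i _; rewrite /= mem_rcons mem_head.
  by apply: sub_all jobsS => a aj; rewrite mem_rcons inE aj orbT.
have old : \sum_(i <- js) completion S' i = \sum_(i <- js) completion S i.
  case: step => M [q [_ _ ->]]; rewrite !big_seq; apply: eq_bigr => i ijs.
  by rewrite completion_append_neq //; apply: contraNneq jjs => <-.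
rewrite big_rcons old /= filter_rcons.
(* A job of length zero gets no part, completes at time 0 and leaves all three bounds unchanged. *)
have [pj0|] := ltrP 0 (p j); last first.
  rewrite le_eqVlt ltNge p_ge0 orbF => /eqP pj0.
  rewrite (greedy_step0 step pj0) in jobsS' *; split=> //.
  suff -> : completion S j = 0 by rewrite addr0.
  rewrite /completion -big_filter (_ : [seq a <- S | _] = [::]) ?big_nil //.
  by elim: (S) Sj => //= a l IHl /andP[/negPf -> /IHl].
have cj := greedy_step_bound step pj0 Sj.
have ld := greedy_step_load step.
(* The new completion time is charged [p j] once, while the bound allows [(1 + alpha) * p j]; this
   is the slack. *)
have apj : 0 <= alpha * p j by rewrite mulr_ge0 ?(ltW alpha_gt0).
rewrite map_rcons prefix_sums_rcons size_rcons !big_rcons big_ord_recr /=.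
rewrite -natr1 natrD.
by split=> //; move: apj cj ld loadS totalS; lra.
Qed.
End Greedy.

(** * Comparison of the two bounds *)

Theorem theorem2 (R : realType) (alpha : R)
  (halpha : (Num.sqrt 17 - 1) / 4 <= alpha)
  (m n : nat) (p : 'I_n -> R) (hp : forall j, 0 <= p j)
  (s : R) (hs : 0 < s)
  (S : schedule R m n) (hS : algorithm_output p s alpha S)
  (T : schedule R m n) (hT : feasible p s T) :
  total_completion S <= (2 + alpha) * total_completion T.
Proof.
have [a0 _] := inv_le_add_half halpha.
have [js [perm_js sorted_js run]] := hS.
have uniq_js : uniq js by rewrite (perm_uniq perm_js) enum_uniq.
(* Both bounds carry a factor [m], so the case without machines is settled apart. *)
have [m0|m_gt0] := posnP m.
  have empty : S = [::].
    by case: (S) => // a l; have := ltn_ord (machine a); lia.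
  rewrite /total_completion big1 => [|j _]; last first.
    by rewrite empty /completion big_nil.
  apply: mulr_ge0; first by rewrite addr_ge0 ?ltW.
  by apply: sumr_ge0 => j _; apply: completion_ge0.
have mR : 0 < m%:R :> R by rewrite ltr0n.
have total U : total_completion U = \sum_(j <- js) completion U j :> R.
  by rewrite (perm_big _ perm_js) big_enum.
have [_ _] := greedy_run_bound hp hs a0 run uniq_js.
rewrite -total; set xs := map _ _ => upper.
(* The same positive jobs as in [xs], now in the order in which [T] completes them. *)
pose J := sort (fun i j => completion T i <= completion T j)
  [seq j <- js | 0 < p j].
have perm_J : perm_eq J [seq j <- js | 0 < p j] by rewrite perm_sort.
have lower : prefix_sums [seq p j | j <- J]
      + s * \sum_(k < size xs) (maxn k.+1 m)%:R
    <= m%:R * total_completion T.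
  have -> : size xs = size J by rewrite size_map (perm_size perm_J).
  apply: le_trans (feasible_total_ge hs hT _ _ _) _.
  - by rewrite (perm_uniq perm_J) filter_uniq.
  - by move=> j; rewrite (perm_mem perm_J) mem_filter => /andP[].
  - by apply: sort_sorted => i j; apply: le_total.
  rewrite ler_wpM2l // total (perm_big _ perm_J) big_filter /=.
  rewrite [leRHS](bigID (fun j => 0 < p j)) /= lerDl.
  by apply: sumr_ge0 => j _; apply: completion_ge0.
have xsJ : prefix_sums xs <= prefix_sums [seq p j | j <- J].
  apply: le_prefix_sums_sorted; first by rewrite perm_map // perm_sym.
  rewrite sorted_map; apply: sorted_filter sorted_js.
  by move=> i j k; apply: le_trans.
have xs_ge0 : all (>= 0) xs by rewrite all_map; apply/allP => j _; apply: hp.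
(* [potential_bound] adds one copy of [prefix_sums xs] to the [1 + alpha] copies in [upper], which
   gives the factor [2 + alpha]. *)
rewrite -(ler_pM2l mR); have := potential_bound m halpha hs xs_ge0.
have a2 : 0 <= 2 + alpha by rewrite addr_ge0 ?ltW.
have := ler_wpM2l a2 lower.
have := ler_wpM2l a2 xsJ.
by move: upper; lra.
Qed.
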